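(* Let $X$ and $W\subseteq X$ be triads, $\iota:W\to X$ a fixed subgraph inclusion, $\mathcal{C}\subseteq\mathcal{T}$ a subcategory and $\sim$ a congruence relation on $\mathcal{C}$. For each triad class ${\rm Tr}_{\mu w}$ define \[F_{\mu w}=\big|\mathsf{Hom}_{\mathcal{C}/\sim}(W,{\rm Tr}_{\mu w})\setminus\mathsf{Hom}^X_{\mathcal{C}/\sim}(W,{\rm Tr}_{\mu w})\big|,\qquad S_{\mu w}=\big|\mathsf{Hom}^X_{\mathcal{C}/\sim}(W,{\rm Tr}_{\mu w})\big|,\] the numbers of open and closed wedges of ${\rm Tr}_{\mu w}$. If the clustering coefficient $\widehat C$ is defined by the rate-of-wedge-closure formula $\widehat C(G)=|\mathsf{Hom}^X_{\mathcal{C}/\sim}(W,G)|/|\mathsf{Hom}_{\mathcal{C}/\sim}(W,G)|$, then for every affiliation network $G$, \[\widehat C(G)=\frac{\sum_{\mu,w}s_{\mu w}(G)\,S_{\mu w}}{\sum_{\mu,w}s_{\mu w}(G)\,(F_{\mu w}+S_{\mu w})}.\]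
   Context: An affiliation network (AN) is a finite simple undirected bipartite graph whose nodes are partitioned into actors and events, every edge joining an actor to an event (the actor attends the event). A graph map $\phi:H\to K$ sends nodes to nodes so that each edge $(v,w)$ of $H$ goes to an edge $(\phi(v),\phi(w))$ of $K$. For a set $S$ of actors of an AN $G$, the subgraph scheduled by $S$ is the subgraph of $G$ induced by $S$ together with all events attended by at least two actors of $S$; a triad of $G$ is the subgraph scheduled by a set of three actors. For integers $\mu_1\ge\mu_2\ge\mu_3\ge0$ and $w\ge0$, ${\rm Tr}_{\mu w}$ (with $\mu=(\mu_1,\mu_2,\mu_3)$) is the AN with three actors $p,q,r$ and exactly $\mu_1$ events attended by exactly $p,q$, $\mu_2$ events attended by exactly $q,r$, $\mu_3$ events attended by exactly $p,r$, and $w$ events attended by all three, and no other nodes. Every triad is isomorphic to exactly one ${\rm Tr}_{\mu w}$; $s_{\mu w}(G)$ denotes the number of triads of $G$ isomorphic to ${\rm Tr}_{\mu w}$, the sums ranging over all $(\mu,w)$. The category $\mathcal{T}$ has as objects triads (ANs with three actors in which every event is attended by at least two actors), and as morphisms $H\to K$ the graph maps sending the actors of $H$ to distinct actors of $K$ and events to events, with the usual composition. A congruence relation on a subcategory $\mathcal{C}$ is a family of equivalence relations on its hom-sets compatible with composition. For an AN $G$ and triad $H$, $\mathsf{Hom}_{\mathcal{C}/\sim}(H,G)$ denotes the set of $\sim$-classes of morphisms in $\mathcal{C}$ from $H$ to any triad of $G$, and $\mathsf{Hom}^X_{\mathcal{C}/\sim}(W,G)$ denotes those classes of $\phi$ that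 factor through $X$ via $\iota$, i.e. $\phi\sim\psi\circ\iota$ for some morphism $\psi$ in $\mathcal{C}$ from $X$ to a triad of $G$. Elements of $\mathsf{Hom}_{\mathcal{C}/\sim}(W,G)$ are wedges, closed if in $\mathsf{Hom}^X_{\mathcal{C}/\sim}(W,G)$ and open otherwise.
   Formalization: The subcategory C is additionally assumed isomorphism-invariant: if a triad is in C, every triad isomorphic to it is in C and isomorphic to it within C; for an arbitrary subcategory the formula fails (e.g. C with one object H = W = X = G not literally a Tr, only the identity). *)

(* Defs.v *)
From mathcomp Require Import all_boot all_order all_algebra.
From mathcomp Require Import boolp classical_sets fsbigop.

Set Implicit Arguments.
Unset Strict Implicit.
Unset Printing Implicit Defensive.

Import Order.TTheory GRing.Theory Num.Theory.

(* The node set is the disjoint union of [actor] and [event]; since every edge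
   joins an actor to an event, the edges are given by a relation between them. *)
Record affnet : Type := AffNet {
  actor : finType;
  event : finType;
  attends : actor -> event -> bool }.

(* Isomorphisms respect the partition into actors and events. *)
Definition an_iso (H K : affnet) : Prop :=
  exists (f : actor H -> actor K) (g : event H -> event K),
    [/\ bijective f, bijective g
      & forall a e, attends (f a) (g e) = attends a e].

Record triad : Type := Triad {
  triad_an :> affnet;
  triad_actors : #|actor triad_an| = 3;
  triad_events :
    forall e : event triad_an, 2 <= #|[set a : actor triad_an | attends a e]| }.

Definition scheduled (G : affnet) (S : {set actor G}) : affnet :=
  @AffNet {a : actor G | a \in S}
          {e : event G | 2 <= #|[set a in S | attends a e]|}
          (fun a e => attends (val a) (val e)).

Definition triple (G : affnet) : finType := {S : {set actor G} | #|S| == 3}.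

Lemma scheduled_actors (G : affnet) (S : triple G) :
  #|actor (scheduled (val S))| = 3.
Proof. by rewrite card_sig; exact/eqP/(valP S). Qed.

Lemma scheduled_events (G : affnet) (S : {set actor G})
    (e : event (scheduled S)) :
  2 <= #|[set a : actor (scheduled S) | attends a e]|.
Proof.
apply: leq_trans (valP e) _.
rewrite -(card_imset _ val_inj); apply/subset_leq_card/fintype.subsetP => a.
rewrite inE => /andP[aS ae].
by apply/imsetP; exists (exist _ a aS); rewrite ?inE.
Qed.

Definition triad_of (G : affnet) (S : triple G) : triad :=
  Triad (scheduled_actors S) (@scheduled_events G (val S)).

(* Morphisms of the category of triads.  A graph map sending actors to actors
   and events to events is a pair of functions. *)
Definition is_tmap (H K : affnet)
    (f : {ffun actor H -> actor K} * {ffun event H -> event K}) : bool :=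
  injectiveb f.1 &&
  [forall a, forall e, attends a e ==> attends (f.1 a) (f.2 e)].

Definition tmap (H K : affnet) : finType :=
  {f : {ffun actor H -> actor K} * {ffun event H -> event K} | is_tmap f}.

Lemma tmap_id_subproof (H : affnet) :
  is_tmap ([ffun a : actor H => a], [ffun e : event H => e]).
Proof.
apply/andP; split=> /=; first by apply/injectiveP => a b; rewrite !ffunE.
by apply/forallP => a; apply/forallP => e; rewrite !ffunE implybb.
Qed.

Definition tmap_id (H : affnet) : tmap H H := exist (@is_tmap H H) _ (tmap_id_subproof H).

Lemma tmap_comp_subproof (H K L : affnet) (g : tmap K L) (f : tmap H K) :
  is_tmap ([ffun a => (val g).1 ((val f).1 a)],
           [ffun e => (val g).2 ((val f).2 e)]).
Proof.
case: g f => [g /= /andP[/injectiveP gi /forallP gE]].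
case=> [f /= /andP[/injectiveP fi /forallP fE]].
apply/andP; split=> /=.
  by apply/injectiveP => a b; rewrite !ffunE => /gi /fi.
apply/forallP => a; apply/forallP => e; rewrite !ffunE; apply/implyP => ae.
by apply: (implyP (forallP (gE _) _)); apply: (implyP (forallP (fE _) _)).
Qed.

Definition tmap_comp (H K L : affnet) (g : tmap K L) (f : tmap H K) : tmap H L :=
  exist (@is_tmap H L) _ (tmap_comp_subproof g f).

(* Inclusion of a subgraph (not necessarily an induced one) that is itself a
   triad, up to renaming nodes; injectivity on actors is part of [tmap]. *)
Definition subgraph_inclusion (W X : triad) (iota : tmap W X) : Prop :=
  injective (val iota).2.

(* Subcategories of the category of triads. *)
Record subcat : Type := SubCat {
  sobj : triad -> Prop;
  shom : forall H K : triad, tmap H K -> Prop;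
  shom_obj : forall (H K : triad) (f : tmap H K),
    shom f -> sobj H /\ sobj K;
  shom_id : forall H : triad, sobj H -> @shom H H (tmap_id H);
  shom_comp : forall (H K L : triad) (g : tmap K L) (f : tmap H K),
    shom g -> shom f -> @shom H L (tmap_comp g f) }.

Definition iso_in (C : subcat) (H K : triad) : Prop :=
  exists (f : tmap H K) (g : tmap K H),
    [/\ shom C f, shom C g,
        tmap_comp g f = tmap_id H & tmap_comp f g = tmap_id K].

(* Membership in C is a property of the isomorphism class of a triad, and
   isomorphic triads remain isomorphic inside C.  Every subcategory that is
   closed under isomorphism (replete) satisfies this. *)
Definition iso_invariant (C : subcat) : Prop :=
  forall H K : triad, an_iso H K -> sobj C H -> iso_in C H K.

Record congruence (C : subcat) : Type := Congruence {
  cong : forall H K : triad, tmap H K -> tmap H K -> Prop;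
  cong_dom : forall (H K : triad) (f g : tmap H K),
    cong f g -> shom C f /\ shom C g;
  cong_refl : forall (H K : triad) (f : tmap H K),
    shom C f -> cong f f;
  cong_sym : forall (H K : triad) (f g : tmap H K),
    cong f g -> cong g f;
  cong_trans : forall (H K : triad) (f g h : tmap H K),
    cong f g -> cong g h -> cong f h;
  cong_comp : forall (H K L : triad) (g g' : tmap K L) (f f' : tmap H K),
    cong g g' -> cong f f' -> @cong H L (tmap_comp g f) (tmap_comp g' f') }.

Section Wedges.
Variables (C : subcat) (sim : congruence C).

Definition cong_class (H K : triad) (f : tmap H K) : {set tmap H K} :=
  [set g | `[< cong sim f g >]].

Definition hom_classes (H K : triad) : {set {set tmap H K}} :=
  [set cong_class f | f in [set f : tmap H K | `[< shom C f >]]].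

Definition factors_via (W X : triad) (iota : tmap W X) (K : triad)
    (phi : tmap W K) : Prop :=
  exists psi : tmap X K, shom C psi /\ cong sim phi (tmap_comp psi iota).

Definition hom_classes_via (W X : triad) (iota : tmap W X) (K : triad)
    : {set {set tmap W K}} :=
  [set cong_class f | f in [set f : tmap W K |
     `[< shom C f >] && `[< factors_via iota f >]]].

(* A morphism remembers its codomain, so wedges in different triads of G are
   distinct: a wedge is a class tagged with the triad of G it lands in. *)
Definition wedge (W : triad) (G : affnet) : finType :=
  {S : triple G & {set tmap W (triad_of S)}}.

Definition wedges (W : triad) (G : affnet) : {set wedge W G} :=
  [set u | tagged u \in hom_classes W (triad_of (tag u))].

Definition closed_wedges (W X : triad) (iota : tmap W X) (G : affnet)
    : {set wedge W G} :=
  [set u | tagged u \in hom_classes_via iota (triad_of (tag u))].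

Definition clustering (W X : triad) (iota : tmap W X) (G : affnet) : rat :=
  (#|closed_wedges iota G|%:R / #|wedges W G|%:R)%R.

End Wedges.

(* The actors p, q, r are 0, 1, 2; an event attended by exactly two actors is
   missed by exactly one. *)
Definition Tr_attends (mu : nat * nat * nat) (w : nat) (a : 'I_3)
    (e : 'I_mu.1.1 + 'I_mu.1.2 + 'I_mu.2 + 'I_w) : bool :=
  match e with
  | inl (inl (inl _)) => a != 2 :> nat
  | inl (inl (inr _)) => a != 0 :> nat
  | inl (inr _) => a != 1 :> nat
  | inr _ => true
  end.

Definition Tr (mu : nat * nat * nat) (w : nat) : affnet :=
  @AffNet 'I_3 ('I_mu.1.1 + 'I_mu.1.2 + 'I_mu.2 + 'I_w)%type (@Tr_attends mu w).

(* All indices (mu, w) with mu = (mu1, mu2, mu3) and mu1 >= mu2 >= mu3. *)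
Definition triad_indices : set (nat * nat * nat * nat) :=
  [set t | t.1.1.1 >= t.1.1.2 /\ t.1.1.2 >= t.1.2]%classic.

Definition triad_count (mu : nat * nat * nat) (w : nat) (G : affnet) : nat :=
  #|[set S : triple G | `[< an_iso (triad_of S) (Tr mu w) >]]|.

Definition open_number (C : subcat) (sim : congruence C) (W X : triad)
    (iota : tmap W X) (mu : nat * nat * nat) (w : nat) : nat :=
  #|wedges sim W (Tr mu w) :\: closed_wedges sim iota (Tr mu w)|.

Definition closed_number (C : subcat) (sim : congruence C) (W X : triad)
    (iota : tmap W X) (mu : nat * nat * nat) (w : nat) : nat :=
  #|closed_wedges sim iota (Tr mu w)|.

(* Main.v *)
(* Counting wedges is additive over the triads of G, because a wedge is tagged
   with the triad it lands in.  Composing with an isomorphism of C permutes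
   the morphisms out of W and respects congruence and factorization through X,
   so the number of (closed) wedges of a triad depends only on its isomorphism
   class.  The classes are the Tr mu w: in a triad an event misses at most one
   actor, so the triad is determined up to isomorphism by the multiset of the
   numbers of events missed by each actor, together with the number of events
   attended by everyone. *)
Require Import Defs.
From mathcomp Require Import all_boot all_order all_algebra.
From mathcomp Require Import perm zify.
From mathcomp Require Import boolp classical_sets fsbigop.

Set Implicit Arguments.
Unset Strict Implicit.
Unset Printing Implicit Defensive.

Import GRing.Theory.

(** * Matching two functions whose fibres have equal sizes *)

(** Equal fibre sizes make the lists of values of [k] and [k'] permutations of each other; such a
    permutation, read on positions in the enumerations, gives [g]. *)
Lemma fiber_bij (E E' : finType) (K : eqType) (k : E -> K) (k' : E' -> K) :
  (forall x, #|[pred e | k e == x]| = #|[pred e | k' e == x]|) ->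
  exists2 g : E' -> E, bijective g & forall e, k (g e) = k' e.
Proof.
move=> eq_card.
have cod (T : finType) (h : T -> K) x :
    count_mem x (codom h) = #|[pred e | h e == x]|.
  by rewrite count_map -size_filter cardE enumT; congr size; exact: eq_filter.
have : perm_eq (codom k') (codom_tuple k).
  by apply/allP => x _ /=; rewrite !cod eq_card.
move=> kk'; have eqE : #|E'| = #|E|.
  by rewrite -(size_codom k') (perm_size kk') size_codom.
have /tuple_permP[p def_k'] := kk'.
exists (fun y => enum_val (p (cast_ord eqE (enum_rank y)))).
  apply: (bij_comp (f := enum_val)); first exact: enum_val_bij.
  apply: (bij_comp (f := p)); first exact: injF_bij perm_inj.
  apply: (bij_comp (f := cast_ord eqE)); last exact: enum_rank_bij.
  by exists (cast_ord (esym eqE)) => i; [exact: cast_ordK|exact: cast_ordKV].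
move=> e; set i := enum_rank e.
(* [k' e] also serves as the default of [nth], since no element of [K] is given in advance. *)
have -> : k' e = nth (k' e) (codom k') i.
  by rewrite nth_codom; rewrite enum_rankK.
rewrite def_k' -[i : nat]/(cast_ord eqE i : nat).
rewrite (nth_map (p (cast_ord eqE i))) ?size_enum_ord // nth_ord_enum.
by rewrite (tnth_nth (k' e)) /= nth_codom.
Qed.

(** * Triads described by the events that each actor misses *)

Definition missing (H : affnet) (a : actor H) : nat :=
  #|[pred e | ~~ attends a e]|.

Definition full_events (H : affnet) : nat :=
  #|[pred e : event H | [forall a, attends a e]]|.

(** Two distinct absentees and at least two attendees would make four actors out of three. *)
Lemma triad_missed_uniq (T : triad) (e : event T) (a b : actor T) :
  ~~ attends a e -> ~~ attends b e -> a = b.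
Proof.
move=> ae be; apply/eqP; case: eqVneq => // ab.
have := triad_events e; rewrite leqNgt ltnS => /negP[].
rewrite -(leq_add2r 2) -[(1 + 2)%N](triad_actors T).
rewrite -(cardsC [set a : actor T | attends a e]) leq_add2l.
have <- : #|[set a; b]| = 2 by rewrite cards2 ab.
by apply/subset_leq_card/fintype.subsetP => c; rewrite !inE => /orP[]/eqP->.
Qed.

(** In a triad this single value fixes who attends the event; [None] marks an event attended by all
    three actors. *)
Definition missed (T : triad) (e : event T) : option (actor T) :=
  [pick a | ~~ attends a e].

Lemma missedE (T : triad) (a : actor T) (e : event T) :
  attends a e = (missed e != Some a).
Proof.
rewrite /missed; case: pickP => [b be|all_e]; last by have /negbFE := all_e a.
have [<-|ab] := eqVneq b a; first by rewrite eqxx (negbTE be).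
rewrite (inj_eq Some_inj) ab; apply/negPn/negP => /triad_missed_uniq ae.
by rewrite -(ae b) ?eqxx in ab.
Qed.

Lemma card_missed_Some (T : triad) (a : actor T) :
  #|[pred e | missed e == Some a]| = missing a.
Proof. by apply: eq_card => e; rewrite !inE missedE negbK. Qed.

Lemma card_missed_None (T : triad) :
  #|[pred e : event T | missed e == None]| = full_events T.
Proof.
apply: eq_card => e; rewrite !inE.
apply/eqP/forallP => [e0 a|]; first by rewrite missedE e0.
by rewrite /missed; case: pickP => // a ae /(_ a); rewrite (negbTE ae).
Qed.

(** After relabelling by [f], the [missed] values of [H] have the same fibre sizes as those of [K],
    so [fiber_bij] supplies the map on events. *)
Lemma triad_iso (H K : triad) (f : actor H -> actor K) :
  bijective f -> (forall a, missing (f a) = missing a) ->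
  full_events H = full_events K -> an_iso H K.
Proof.
move=> f_bij eq_miss eq_full; have [f' fK f'K] := f_bij.
pose k (e : event H) := omap f (missed e).
have [|g g_bij gE] := @fiber_bij _ _ _ (@missed K) k.
  case=> [b|].
    rewrite card_missed_Some -(f'K b) eq_miss -card_missed_Some.
    apply: eq_card => e; rewrite !inE /k.
    by case: missed => //= a; rewrite !(inj_eq Some_inj) (can_eq fK).
  rewrite card_missed_None -eq_full -card_missed_None.
  by apply: eq_card => e; rewrite !inE /k; case: missed.
exists f, g; split=> // a e; rewrite !missedE gE /k.
by case: missed => //= b; rewrite !(inj_eq Some_inj) (can_eq fK).
Qed.

Lemma an_iso_sym (H K : affnet) : an_iso H K -> an_iso K H.
Proof.
move=> [f [g [[f' fK f'K] [g' gK g'K] fg]]]; exists f', g'.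
by split=> [||a e]; [exists f|exists g|rewrite -fg f'K g'K].
Qed.

(** * The index of a triad and its canonical form *)

Definition missing_seq (H : affnet) : seq nat :=
  sort geq [seq missing a | a : actor H].

(** In a triad, an event attended by exactly two actors is one missed by the third, so the sorted
    missing numbers are the parameters [mu] of its class. *)
Definition triad_index (H : affnet) : nat * nat * nat * nat :=
  let s := missing_seq H in ((s`_0, s`_1, s`_2), full_events H)%R.

Lemma missing_seq_sorted H : sorted geq (missing_seq H).
Proof. by apply: sort_sorted => m n; exact: leq_total. Qed.

Lemma geq_sorted_eq (s t : seq nat) :
  sorted geq s -> sorted geq t -> perm_eq s t -> s = t.
Proof.
apply: sorted_eq => [m n p /= mn pm|m n]; first exact: leq_trans pm mn.
by move/anti_leq.
Qed.

Lemma triad_index_iso (H K : affnet) :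
  an_iso H K -> triad_index H = triad_index K.
Proof.
move=> [f [g [f_bij g_bij fg]]].
have [f' fK f'K] := f_bij; have [g' gK g'K] := g_bij.
have missf a : missing (f a) = missing a.
  rewrite /missing -!sum1_card (reindex g) /=; last exact: onW_bij.
  by apply: eq_bigl => e; rewrite !inE fg.
have fullE : full_events H = full_events K.
  rewrite /full_events -!sum1_card [RHS](reindex g) /=; last exact: onW_bij.
  apply: eq_bigl => e; rewrite !inE; apply/forallP/forallP => all_e a.
    by rewrite -(f'K a) fg.
  by rewrite -fg.
suff missE : missing_seq H = missing_seq K by rewrite /triad_index missE fullE.
apply: (geq_sorted_eq (missing_seq_sorted _) (missing_seq_sorted _)).
rewrite /missing_seq perm_sort perm_sym perm_sort.
(* The numbers for [H] are listed through the images [f a], which run once over the actors of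
   [K]. *)
have -> : [seq missing a | a : actor H] =
          [seq missing b | b <- [seq f a | a <- enum (actor H)]].
  by rewrite -map_comp; apply: eq_map => a /=.
apply/perm_map/uniq_perm.
- exact: enum_uniq.
- by rewrite map_inj_uniq ?enum_uniq //; exact: bij_inj.
by move=> a; rewrite mem_enum -[a]f'K map_f ?mem_enum.
Qed.

Lemma size_missing_seq (T : triad) : size (missing_seq T) = 3.
Proof. by rewrite size_sort size_image triad_actors. Qed.

Lemma triad_index_in (T : triad) : triad_indices (triad_index T).
Proof.
have := missing_seq_sorted T; have := size_missing_seq T.
rewrite /triad_indices /triad_index /=.
case: (missing_seq T) => [|x[|y[|z[|]]]] //= _.
by case/and3P.
Qed.

Lemma Tr_events mu w (e : event (Tr mu w)) :
  2 <= #|[set a : actor (Tr mu w) | attends a e]|.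
Proof.
by case: e => [[[e|e]|e]|e];
  rewrite -sum1_card big_mkcond !big_ord_recl big_ord0 !inE.
Qed.

Definition Tr_triad mu w : triad :=
  @Triad (Tr mu w) (card_ord 3) (@Tr_events mu w).

(** The order is rotated because [mu] lists attending pairs: p misses the q,r events, q the p,r
    events, and r the p,q events. *)
Lemma Tr_missing m1 m2 m3 w i :
  @missing (Tr (m1, m2, m3) w) i = nth 0 [:: m2; m3; m1] i.
Proof.
rewrite /missing -sum1_card (eq_bigl (fun e => ~~ Tr_attends i e)) //.
rewrite big_mkcond /= !big_sumType /=.
by case: i => [[|[|[|//]]] ilt] /=; rewrite !sum_nat_const !card_ord; lia.
Qed.

Lemma Tr_full_events mu w : full_events (Tr mu w) = w.
Proof.
rewrite /full_events -sum1_card.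
rewrite (eq_bigl (fun e => [forall a, @Tr_attends mu w a e])) //.
rewrite big_mkcond /= !big_sumType /=.
have full0 i (P : pred 'I_3) : ~~ P i -> [forall a, P a] = false.
  by move=> Pi; apply/negbTE/forallPn; exists i.
rewrite -[RHS]add0n; congr (_ + _)%N; last first.
  rewrite (eq_bigr (fun=> 1)) ?sum1_card ?card_ord // => i _.
  by case: forallP => // -[].
(* Each of the three families is excluded by the actor who misses it: 1 for the third, 0 for the
   second, 2 for the first. *)
rewrite !big1 // => i _; first by rewrite (full0 1%R).
  by rewrite (full0 0%R).
by rewrite (full0 2%R).
Qed.

Lemma Tr_index mu w : triad_indices (mu, w) -> triad_index (Tr mu w) = (mu, w).
Proof.
case: mu => [[m1 m2] m3] [/= m21 m32].
suff missE : missing_seq (Tr (m1, m2, m3) w) = [:: m1; m2; m3].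
  by rewrite /triad_index missE Tr_full_events.
apply: geq_sorted_eq; rewrite ?missing_seq_sorted //= ?m21 ?m32 //.
rewrite perm_sort /image_mem !enum_ordSl enum_ord0 /= !Tr_missing.
by rewrite -(perm_rot 2).
Qed.

Lemma an_iso_Tr_index (T : triad) :
  an_iso T (Tr (triad_index T).1 (triad_index T).2).
Proof.
pose leM (a b : actor T) := geq (missing a) (missing b).
pose s := sort leM (enum (actor T)).
have sE : missing_seq T = map (@missing T) s by rewrite /missing_seq sort_map.
have : uniq s by rewrite sort_uniq enum_uniq.
have : size s = 3 by rewrite size_sort -cardE triad_actors.
rewrite /triad_index sE; case: s {sE} => [|a [|b [|c [|]]]] //= _ abc_uniq.
apply: an_iso_sym.
(* Here [a], [b], [c] miss ever fewer events, while in [Tr] actor 2 misses the most, then 0, then 1;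
   hence the rotated list. *)
pose f (i : 'I_3) := nth a [:: b; c; a] i.
apply: (@triad_iso (Tr_triad _ _) T f); last exact: Tr_full_events.
  apply: inj_card_bij; last by rewrite triad_actors card_ord.
  move=> i j /eqP; rewrite nth_uniq //; first by move/eqP/val_inj.
  by rewrite (rot_uniq 1 [:: a; b; c]).
by move=> i; rewrite Tr_missing; case: i => [[|[|[|//]]] ilt].
Qed.

Lemma an_iso_TrP (T : triad) t :
  triad_indices t -> an_iso T (Tr t.1 t.2) <-> triad_index T = t.
Proof.
case: t => mu w tP; split=> [/triad_index_iso->|<-]; first exact: Tr_index.
exact: an_iso_Tr_index.
Qed.

(** * Sums over the triads of a network *)

(** The triple must be the whole actor set, and no event is dropped since each has two attendees.
    Only an isomorphism results, as [triad_of S] lives on subtypes. *)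
Lemma triad_of_triad (T : triad) (S : triple T) : an_iso (triad_of S) T.
Proof.
have ST : val S = [set: actor T].
  apply/eqP; rewrite eqEcard finset.subsetT cardsT triad_actors.
  by rewrite (eqP (valP S)).
exists val, val; split=> //; apply: inj_card_bij; try exact: val_inj.
  by rewrite card_sig (eqP (valP S)) triad_actors.
rewrite card_sig; apply: subset_leq_card; apply/fintype.subsetP => e _.
rewrite !inE ST; apply: leq_trans (triad_events e) _.
by apply/subset_leq_card/fintype.subsetP => a; rewrite !inE.
Qed.

Lemma sum_triad (h : triad -> nat) (T : triad) :
  (forall H K : triad, an_iso H K -> h H = h K) ->
  \sum_(S : triple T) h (triad_of S) = h T.
Proof.
move=> h_iso.
under eq_bigr => S _ do rewrite (h_iso _ _ (triad_of_triad S)).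
rewrite sum_nat_const card_sig.
have -> : #|[pred S : {set actor T} | #|S| == 3]| = 1; last by rewrite mul1n.
by have := card_draws (actor T) 3; rewrite triad_actors binn cardsE.
Qed.

Lemma sum_triples (h : triad -> nat) (G : affnet) :
  (forall H K : triad, an_iso H K -> h H = h K) ->
  ((\sum_(S : triple G) h (triad_of S))%N%:R =
   \sum_(t \in triad_indices)
     ((triad_count t.1 t.2 G)%:R * (h (Tr_triad t.1 t.2))%:R : rat))%R.
Proof.
move=> h_iso; pose ix (S : triple G) := triad_index (triad_of S).
have countE t : triad_indices t ->
    triad_count t.1 t.2 G = \sum_(S : triple G) (ix S == t).
  move=> tP; rewrite /triad_count -sum1dep_card big_mkcond.
  apply: eq_bigr => S _.
  suff -> : `[< an_iso (triad_of S) (Tr t.1 t.2) >] = (ix S == t).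
    by case: eqP.
  by apply/asboolP/eqP => /(an_iso_TrP _ tP).
(* Only indices realised by some triple of [G] contribute, so the sum has finite support. *)
rewrite (fsbigE (undup (codom ix))) ?undup_uniq //; first last.
- move=> t tP; rewrite mem_undup => tNix; rewrite countE // big1 ?mul0r //.
  move=> S _; apply/eqP; rewrite eqb0.
  by apply: contraNneq tNix => <-; exact: codom_f.
- by move=> t; rewrite /= mem_undup => /codomP[S ->]; exact: triad_index_in.
under [RHS]eq_bigr => t tP
  do rewrite (countE t (set_mem tP)) -natrM big_distrl /=.
rewrite -natr_sum; congr (_%:R)%R; rewrite exchange_big /=.
apply: eq_bigr => S _.
have SP : triad_indices (ix S) by exact: triad_index_in.
(* For a fixed triple [S], only the term [t = ix S] survives. *)
rewrite big_mkcond (bigD1_seq (ix S)) ?undup_uniq ?mem_undup ?codom_f //=.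
rewrite (mem_set SP) eqxx mul1n big1 ?addn0 => [|t]; last first.
  by rewrite eq_sym => /negbTE->; case: ifP.
exact/h_iso/an_iso_Tr_index.
Qed.

(** * Congruence classes transported along isomorphisms *)

Lemma tmap_compA (H K L M : affnet) (h : tmap L M) (g : tmap K L)
    (f : tmap H K) : tmap_comp h (tmap_comp g f) = tmap_comp (tmap_comp h g) f.
Proof. by apply: val_inj; congr (_, _); apply/ffunP => x; rewrite !ffunE. Qed.

Lemma tmap_comp_id (H K : affnet) (f : tmap H K) : tmap_comp (tmap_id K) f = f.
Proof.
apply: val_inj; case: f => [[f1 f2] ?].
by congr (_, _); apply/ffunP => x; rewrite !ffunE.
Qed.

Section Classes.
Variables (C : subcat) (sim : congruence C).

(** Composing with the inverse [g] pulls any morphism congruent to [tmap_comp f phi] back to one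
    congruent to [phi]. *)
Lemma cong_class_comp (W H K : triad) (f : tmap H K) (g : tmap K H)
    (phi : tmap W H) :
  shom C f -> shom C g ->
  tmap_comp g f = tmap_id H -> tmap_comp f g = tmap_id K ->
  cong_class sim (tmap_comp f phi) = tmap_comp f @: cong_class sim phi.
Proof.
move=> Cf Cg gf fg; apply/setP => psi; rewrite inE.
apply/asboolP/imsetP => [eq_psi|[chi]].
  exists (tmap_comp g psi).
    rewrite inE; apply/asboolP.
    have := cong_comp (cong_refl sim Cg) eq_psi.
    by rewrite tmap_compA gf tmap_comp_id.
  by rewrite tmap_compA fg tmap_comp_id.
by rewrite inE => /asboolP phi_chi ->; apply: cong_comp => //; exact: cong_refl.
Qed.

(** [Phi] stands for either all morphisms of [C] or those factoring through [X]. Exchanging [f] and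
    [g] later gives the reverse inequality. *)
Lemma leq_card_classes (W : triad) (Phi : forall K : triad, {set tmap W K}) :
  (forall (H K : triad) (f : tmap H K) phi,
     shom C f -> phi \in Phi H -> tmap_comp f phi \in Phi K) ->
  forall H K : triad, iso_in C H K ->
  #|@cong_class _ sim W H @: Phi H| <= #|@cong_class _ sim W K @: Phi K|.
Proof.
move=> Phi_comp H K [f [g [Cf Cg gf fg]]].
have f_inj : injective (@tmap_comp W _ _ f).
  apply: (can_inj (g := tmap_comp g)) => phi.
  by rewrite tmap_compA gf tmap_comp_id.
rewrite -(card_imset _ (imset_inj f_inj)).
apply/subset_leq_card/fintype.subsetP => _ /imsetP[_ /imsetP[phi phiP ->] ->].
rewrite -(cong_class_comp phi Cf Cg gf fg); apply: imset_f.
exact: Phi_comp.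
Qed.

Hypothesis C_iso : iso_invariant C.

Lemma card_classes_iso (W : triad) (Phi : forall K : triad, {set tmap W K}) :
  (forall (K : triad) phi, phi \in Phi K -> shom C phi) ->
  (forall (H K : triad) (f : tmap H K) phi,
     shom C f -> phi \in Phi H -> tmap_comp f phi \in Phi K) ->
  forall H K : triad, an_iso H K ->
  #|@cong_class _ sim W H @: Phi H| = #|@cong_class _ sim W K @: Phi K|.
Proof.
move=> Phi_hom Phi_comp H K HK.
(* [C_iso] yields an isomorphism only for objects of [C]; outside [C] there are no morphisms and
   both counts vanish. *)
have Phi0 (L : triad) : ~ sobj C L -> Phi L = finset.set0.
  move=> NL; apply/setP => phi; rewrite inE; apply/negP => /Phi_hom Cphi.
  by apply: NL; have [] := shom_obj Cphi.
have [CH|NH] := pselect (sobj C H).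
  have [f [g [Cf Cg gf fg]]] := C_iso HK CH.
  by apply/eqP; rewrite eqn_leq !leq_card_classes //; [exists g, f|exists f, g].
have NK : ~ sobj C K.
  move=> CK; have [f [_ [Cf _ _ _]]] := C_iso (an_iso_sym HK) CK.
  by apply: NH; have [] := shom_obj Cf.
by rewrite !Phi0 // !imset0 !cards0.
Qed.

Lemma card_hom_classes_iso (W H K : triad) :
  an_iso H K -> #|hom_classes sim W H| = #|hom_classes sim W K|.
Proof.
move: H K; apply: card_classes_iso => [K phi|H K f phi Cf].
  by rewrite inE => /asboolP.
by rewrite inE => /asboolP Cphi; rewrite inE; apply/asboolP; exact: shom_comp.
Qed.

Lemma card_hom_classes_via_iso (W X H K : triad) (iota : tmap W X) :
  an_iso H K -> #|hom_classes_via sim iota H| = #|hom_classes_via sim iota K|.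
Proof.
move: H K; apply: card_classes_iso => [K phi|H K f phi Cf].
  by rewrite inE => /andP[/asboolP].
rewrite inE => /andP[/asboolP Cphi /asboolP[psi [Cpsi phi_psi]]].
rewrite inE; apply/andP; split; apply/asboolP; first exact: shom_comp.
exists (tmap_comp f psi); split; first exact: shom_comp.
by rewrite -tmap_compA; apply: cong_comp => //; exact: cong_refl.
Qed.

(** * Counting open and closed wedges *)

Lemma card_tagged_set (I : finType) (J : I -> finType)
    (A : forall i, {set J i}) :
  #|[set u : {i : I & J i} | tagged u \in A (tag u)]| = \sum_i #|A i|.
Proof.
under eq_bigr do rewrite -sum1_card.
by rewrite sig_big_dep -sum1_card; apply: eq_bigl => u; rewrite inE.
Qed.

Lemma card_wedges (W : triad) (G : affnet) :
  #|wedges sim W G| = \sum_(S : triple G) #|hom_classes sim W (triad_of S)|.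
Proof. exact: card_tagged_set. Qed.

Lemma card_closed_wedges (W X : triad) (iota : tmap W X) (G : affnet) :
  #|closed_wedges sim iota G| =
  \sum_(S : triple G) #|hom_classes_via sim iota (triad_of S)|.
Proof. exact: card_tagged_set. Qed.

Lemma closed_wedges_sub (W X : triad) (iota : tmap W X) (G : affnet) :
  closed_wedges sim iota G \subset wedges sim W G.
Proof.
apply/fintype.subsetP => u; rewrite !inE => /imsetP[phi + ->].
by rewrite inE => /andP[Cphi _]; apply: imset_f; rewrite inE.
Qed.

(** As a network, [Tr mu w] has a single triad, isomorphic to itself, so [sum_triad] turns its
    wedges into classes of morphisms to [Tr_triad mu w]. *)
Lemma open_closed_number (W X : triad) (iota : tmap W X) mu w :
  open_number sim iota mu w + closed_number sim iota mu w =
  #|hom_classes sim W (Tr_triad mu w)|.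
Proof.
rewrite addnC -(sum_triad (Tr_triad mu w) (@card_hom_classes_iso W)).
rewrite -card_wedges -(cardsID (closed_wedges sim iota (Tr mu w))).
by rewrite (finset.setIidPr (closed_wedges_sub _ _)).
Qed.

Lemma closed_numberE (W X : triad) (iota : tmap W X) mu w :
  closed_number sim iota mu w = #|hom_classes_via sim iota (Tr_triad mu w)|.
Proof.
rewrite -(sum_triad (Tr_triad mu w)
            (fun H K => @card_hom_classes_via_iso W X H K iota)).
by rewrite -card_closed_wedges.
Qed.

End Classes.

Local Open Scope ring_scope.

Theorem theorem1 (W X : triad) (iota : tmap W X)
    (iotaP : subgraph_inclusion iota)
    (C : subcat) (C_iso : iso_invariant C) (sim : congruence C)
    (G : affnet) :
  clustering sim iota G =
    (\sum_(t \in triad_indices)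
       ((triad_count t.1 t.2 G)%:R * (closed_number sim iota t.1 t.2)%:R : rat)) /
    (\sum_(t \in triad_indices)
       ((triad_count t.1 t.2 G)%:R *
        ((open_number sim iota t.1 t.2)%:R
         + (closed_number sim iota t.1 t.2)%:R) : rat)).
Proof.
rewrite /clustering card_closed_wedges card_wedges.
rewrite (sum_triples _
  (fun H K => @card_hom_classes_via_iso _ sim C_iso W X H K iota)).
rewrite (sum_triples _ (@card_hom_classes_iso _ sim C_iso W)).
congr (_ / _); apply: eq_fsbigr => t _.
  by rewrite (closed_numberE sim C_iso).
by rewrite -natrD (open_closed_number sim C_iso).
Qed.
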